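(* Let $G$ be a discrete group, and let $\Phi\colon\ell^1(G)\to\ell^1(G)$ be a surjective approximately local isometric automorphism. Then $\Phi$ is an isometric automorphism of $\ell^1(G)$.
   Context: For a discrete group $G$, the Haar measure is the counting measure, and $\ell^1(G)$ denotes the group algebra of $G$: the complex Banach space of summable functions on $G$ with the $\ell^1$-norm and the convolution product. An isometric automorphism of a Banach algebra $\mathcal{A}$ is a bijective linear multiplicative map $\mathcal{A}\to\mathcal{A}$ that preserves the norm. A linear map $\Phi\colon\mathcal{A}\to\mathcal{A}$ is an approximately local isometric automorphism if for each $a\in\mathcal{A}$ there exists a sequence $(\Phi_{a,n})$ of isometric automorphisms of $\mathcal{A}$ such that $\Phi(a)=\lim_{n\to\infty}\Phi_{a,n}(a)$ in norm. *)

(* Defs.v *)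
From HB Require Import structures.
From mathcomp Require Import all_boot all_order all_algebra.
From mathcomp Require Import complex.
From mathcomp Require Import mathcomp_extra boolp classical_sets functions cardinality fsbigop.
From mathcomp Require Import reals ereal topology normedtype sequences numfun esum.

Set Implicit Arguments.
Unset Strict Implicit.
Unset Printing Implicit Defensive.
Import Order.TTheory GRing.Theory Num.Theory.
Import numFieldNormedType.Exports.
Import Normc.

Local Open Scope classical_set_scope.
Local Open Scope ring_scope.

Section unordered_sum.
Variable R : realType.
Implicit Types T : choiceType.

(* Unordered sums, meaningful for absolutely summable families only: the sum of
   the positive parts minus the sum of the negative parts, taken on the real
   and imaginary parts of a complex family. *)
Definition rsum T (f : T -> R) : R :=
  fine (\esum_(x in setT) (EFin \o f)^\+ x)%E -
  fine (\esum_(x in setT) (EFin \o f)^\- x)%E.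

Definition csum T (f : T -> R[i]) : R[i] :=
  Complex (rsum (fun x => complex.Re (f x))) (rsum (fun x => complex.Im (f x))).

Let S T (f : T -> R) : \bar R := (\esum_(x in setT) (f x)%:E)%E.

Let S_ge0 T (f : T -> R) : (forall x, 0 <= f x) -> (0 <= S f)%E.
Proof. by move=> f0; apply: esum_ge0 => x _; rewrite lee_fin. Qed.

Let le_S T (f g : T -> R) : (forall x, f x <= g x) -> (S f <= S g)%E.
Proof. by move=> fg; apply: le_esum => x _; rewrite lee_fin. Qed.

Let SD T (f g : T -> R) : (forall x, 0 <= f x) -> (forall x, 0 <= g x) ->
  S (fun x => f x + g x) = (S f + S g)%E.
Proof.
by move=> f0 g0; rewrite -esumD// => x _; rewrite lee_fin.
Qed.

Let SZ_le T (c : R) (f : T -> R) : 0 < c -> (forall x, 0 <= f x) ->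
  (S (fun x => (c * f x)%R) <= c%:E * S f)%E.
Proof.
move=> c0 f0; apply: ge_ereal_sup => _ [A [finA _] <-].
rewrite fsbig_finite//=; under eq_bigr do rewrite EFinM.
rewrite -ge0_sume_distrr; last by move=> x _; rewrite lee_fin.
rewrite lee_pmul2l// -fsbig_finite//.
by apply: ereal_sup_ubound; exists A.
Qed.

Lemma esumZl T (c : R) (f : T -> R) : 0 <= c -> (forall x, 0 <= f x) ->
  (\esum_(x in setT) (c * f x)%:E = c%:E * \esum_(x in setT) (f x)%:E)%E.
Proof.
rewrite le_eqVlt => /orP[/eqP <-|c0] f0.
  by rewrite mul0e esum1// => x _; rewrite mul0r.
apply/eqP; rewrite eq_le SZ_le//= -!/(S _).
have cf0 x : 0 <= c * f x by rewrite mulr_ge0// ltW.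
have cV0 : 0 < c^-1 by rewrite invr_gt0.
have := SZ_le cV0 cf0; rewrite (_ : (fun x => _) = f); last first.
  by apply/funext => x; rewrite mulKf ?gt_eqF.
move=> Sfle.
apply: (@le_trans _ _ (c%:E * (c^-1%:E * S (fun x => (c * f x)%R)))%E).
  by rewrite lee_pmul2l.
by rewrite muleA -EFinM divff ?gt_eqF// mul1e.
Qed.

Let S_fin T (f g : T -> R) : (forall x, 0 <= f x) -> (forall x, f x <= g x) ->
  (S g < +oo)%E -> S f \is a fin_num.
Proof.
move=> f0 fg gfin; rewrite ge0_fin_numE ?S_ge0//.
exact: le_lt_trans (le_S fg) gfin.
Qed.

Lemma esum_swap T1 T2 (F : T1 -> T2 -> R) : (forall x y, 0 <= F x y) ->
  (\esum_(x in setT) \esum_(y in setT) (F x y)%:E =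
   \esum_(y in setT) \esum_(x in setT) (F x y)%:E)%E.
Proof.
move=> F0; rewrite esum_esum; last by move=> *; rewrite lee_fin.
rewrite esum_esum; last by move=> *; rewrite lee_fin.
rewrite (reindex_esum (setT `*`` fun=> setT) _ (fun x => (x.2, x.1)))//.
split=> //=; first by move=> [i1 i2] [j1 j2] /= _ _ [] -> ->.
by move=> [i1 i2] _ /=; exists (i2, i1).
Qed.

Let SZ T (c : R) (f : T -> R) : 0 <= c -> (forall x, 0 <= f x) ->
  S (fun x => c * f x) = (c%:E * S f)%E.
Proof. exact: esumZl. Qed.

Let S_swap T1 T2 (F : T1 -> T2 -> R) : (forall x y, 0 <= F x y) ->
  (\esum_(x in setT) S (F x) = \esum_(y in setT) S (fun x => F x y))%E.
Proof. exact: esum_swap. Qed.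

Let rsumB T (f g : T -> R) : (forall x, 0 <= f x) -> (forall x, 0 <= g x) ->
  (S f < +oo)%E -> (S g < +oo)%E ->
  rsum (fun x => f x - g x) = fine (S f) - fine (S g).
Proof.
move=> f0 g0 Sf Sg.
have sm (h : T -> R) : (forall x, 0 <= h x) -> (S h < +oo)%E ->
    summable setT (EFin \o h).
  move=> h0; apply: le_lt_trans; apply: le_esum => x _ /=.
  by rewrite lee_fin ger0_norm.
have := @esumB R T setT (EFin \o f) (EFin \o g) (sm _ f0 Sf) (sm _ g0 Sg)
  (fun i _ => f0 i) (fun i _ => g0 i).
have fin_S h : (forall x, 0 <= h x) -> (S h < +oo)%E -> S h \is a fin_num.
  by move=> h0 ?; rewrite ge0_fin_numE ?S_ge0.
have := summableB (sm _ f0 Sf) (sm _ g0 Sg).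
have -> : ((EFin \o f) \- (EFin \o g))%E = EFin \o (fun x => f x - g x).
  by apply/funext => x.
move=> sfg /(congr1 fine); rewrite -!/(S _).
have fin_e (h : T -> \bar R) : (forall x, 0 <= h x)%E -> summable setT h ->
    (\esum_(i in setT) h i \is a fin_num)%E.
  move=> h0 sh; rewrite ge0_fin_numE; last by apply: esum_ge0.
  by apply: le_lt_trans sh; apply: le_esum => x _; rewrite gee0_abs.
rewrite fineB; [|apply: fin_e..].
- by rewrite fineB ?fin_S.
- by move=> x; exact: funepos_ge0.
- exact: summable_funepos.
- by move=> x; exact: funeneg_ge0.
- exact: summable_funeneg.
Qed.


Let rsumE T (f : T -> R) :
  rsum f = fine (S (fun x => Num.max (f x) 0)) -
           fine (S (fun x => Num.max (- f x) 0)).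
Proof.
by rewrite /rsum /S; congr (fine _ - fine _); apply: eq_esum => x _;
  rewrite (funeposE, funenegE) /= -?EFinN -EFin_max.
Qed.

Let pos_ge0 (x : R) : 0 <= Num.max x 0. Proof. by rewrite le_max lexx orbT. Qed.

Let pos_le (x : R) : Num.max x 0 <= `|x|.
Proof. by rewrite ge_max ler_norm normr_ge0. Qed.

Let neg_le (x : R) : Num.max (- x) 0 <= `|x|.
Proof. by rewrite -normrN pos_le. Qed.

Let posneg (x : R) : x = Num.max x 0 - Num.max (- x) 0.
Proof.
have [x0|/ltW x0] := leP 0 x.
  by rewrite [Num.max (- x) 0]max_r ?oppr_le0// subr0.
by rewrite [Num.max (- x) 0]max_l ?oppr_ge0// sub0r opprK.
Qed.

Let Spos_fin T (f : T -> R) : (S (fun x => `|f x|)%R < +oo)%E ->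
  (S (fun x => Num.max (f x) 0)%R < +oo)%E.
Proof. by apply: le_lt_trans; apply: le_S => x; exact: pos_le. Qed.

Let Sneg_fin T (f : T -> R) : (S (fun x => `|f x|)%R < +oo)%E ->
  (S (fun x => Num.max (- f x) 0)%R < +oo)%E.
Proof. by apply: le_lt_trans; apply: le_S => x; exact: neg_le. Qed.

Let rsumD T (f g : T -> R) : (S (fun x => `|f x|)%R < +oo)%E ->
  (S (fun x => `|g x|)%R < +oo)%E ->
  rsum (fun x => f x + g x) = rsum f + rsum g.
Proof.
move=> Sf Sg; rewrite (rsumE f) (rsumE g) addrACA -opprD.
have fin h : (forall x : T, 0 <= h x) -> (S h < +oo)%E -> S h \is a fin_num.
  by move=> h0 ?; rewrite ge0_fin_numE ?S_ge0.
have p1 := fin _ (fun x => pos_ge0 (f x)) (Spos_fin Sf).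
have p2 := fin _ (fun x => pos_ge0 (g x)) (Spos_fin Sg).
have n1 := fin _ (fun x => pos_ge0 (- f x)) (Sneg_fin Sf).
have n2 := fin _ (fun x => pos_ge0 (- g x)) (Sneg_fin Sg).
rewrite -!fineD// -!SD//.
rewrite -rsumB ?SD//.
- by congr rsum; apply/funext => x; rewrite {1}(posneg (f x)) {1}(posneg (g x))
    opprD addrACA.
- by move=> x; rewrite addr_ge0.
- by move=> x; rewrite addr_ge0.
- by rewrite ltey_eq fin_numD p1 p2.
- by rewrite ltey_eq fin_numD n1 n2.
Qed.

Let rsumN T (f : T -> R) : rsum (fun x => - f x) = - rsum f.
Proof.
rewrite !rsumE opprB; congr (_ - fine (S _)).
by apply/funext => x; rewrite opprK.
Qed.

Let rsumZ T (c : R) (f : T -> R) : (S (fun x => `|f x|)%R < +oo)%E ->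
  rsum (fun x => c * f x) = c * rsum f.
Proof.
wlog c0 : c / 0 <= c => [H Sf|Sf].
  have [/H ->//|c0] := leP 0 c.
  rewrite -[c in RHS]opprK mulNr -H ?oppr_ge0 1?ltW// -rsumN.
  by congr rsum; apply/funext => x; rewrite mulNr opprK.
rewrite !rsumE mulrBr.
have E h : (forall x : T, 0 <= h x) -> fine (S (fun x => c * h x)) = c * fine (S h).
  move=> h0; rewrite SZ//; have := S_ge0 h0; case: (S h) => [r| |]//= _.
  have [->|cn] := eqVneq c 0; first by rewrite mul0e mul0r.
  by rewrite mulr0 muleC mulr_infty gtr0_sg ?lt_def ?cn// mul1e.
rewrite -!E//; congr (fine _ - fine _); congr (S _); apply/funext => x.
  by rewrite maxr_pMr// mulr0.
by rewrite maxr_pMr// mulr0 mulrN.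
Qed.

Let rsum_le T (f g : T -> R) : (forall x, f x <= g x) -> (forall x, 0 <= g x) ->
  (S g < +oo)%E -> rsum f <= fine (S g).
Proof.
move=> fg g0 Sg; rewrite rsumE lerBlDr.
have fle x : Num.max (f x) 0 <= g x by rewrite ge_max fg g0.
rewrite (@le_trans _ _ (fine (S g)))//.
  by rewrite fine_le ?le_S//; [exact: S_fin Sg|exact: (S_fin g0 (fun x => lexx _))].
by rewrite lerDl fine_ge0// S_ge0.
Qed.

Let rsum_reindex T T' (e : T -> T') (f : T' -> R) : set_bij setT setT e ->
  rsum f = rsum (fun x => f (e x)).
Proof.
by move=> be; rewrite !rsumE /S !(reindex_esum setT setT e).
Qed.

Let rsum1 T (a : T) (f : T -> R) : (forall x, x != a -> f x = 0) -> rsum f = f a.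
Proof.
move=> f0; rewrite rsumE.
have E h : (forall x : T, 0 <= h x) -> (forall x, x != a -> h x = 0) -> fine (S h) = h a.
  move=> h0 h1; rewrite /S (esumID [set a])//; last by move=> x _; rewrite lee_fin.
  rewrite setTI setTI esum_set1 ?lee_fin// esum1 ?adde0//.
  by move=> x /= /eqP xa; rewrite h1.
rewrite (E (fun x => Num.max (f x) 0))//; last by move=> x /f0 ->; rewrite maxxx.
rewrite (E (fun x => Num.max (- f x) 0)) => [|x|]; [|exact: pos_ge0|].
  exact/esym/posneg.
by move=> x /f0 ->; rewrite oppr0 maxxx.
Qed.

Let rsum_swap T1 T2 (F : T1 -> T2 -> R) :
  (\esum_(x in setT) S (fun y => `|F x y|)%R < +oo)%E ->
  rsum (fun x => rsum (F x)) = rsum (fun y => rsum (F ^~ y)).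
Proof.
gen have E : T1 T2 F / (\esum_(x in setT) S (fun y => `|F x y|)%R < +oo)%E ->
    rsum (fun x => rsum (F x)) =
    fine (\esum_(x in setT) S (fun y => Num.max (F x y) 0)) -
    fine (\esum_(x in setT) S (fun y => Num.max (- F x y) 0)).
  move=> SF.
  have SFx x : (S (fun y => `|F x y|)%R < +oo)%E.
    apply: le_lt_trans SF; rewrite (esumID [set x])//.
      rewrite setTI esum_set1 ?S_ge0// leeDl// esum_ge0// => *; exact: S_ge0.
    by move=> *; exact: S_ge0.
  under [X in rsum X]eq_fun do rewrite rsumE.
  have P x : (fine (S (fun y => Num.max (F x y) 0)))%:E = S (fun y => Num.max (F x y) 0).
    by rewrite fineK// (S_fin _ _ (SFx x)).
  have N x : (fine (S (fun y => Num.max (- F x y) 0)))%:E = S (fun y => Num.max (- F x y) 0).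
    by rewrite fineK// (S_fin _ _ (SFx x)).
  have SP : S (fun x => fine (S (fun y => Num.max (F x y) 0))) =
      (\esum_(x in setT) S (fun y => Num.max (F x y) 0)%R)%E.
    by apply: eq_esum => x _; rewrite P.
  have SN : S (fun x => fine (S (fun y => Num.max (- F x y) 0))) =
      (\esum_(x in setT) S (fun y => Num.max (- F x y) 0)%R)%E.
    by apply: eq_esum => x _; rewrite N.
  rewrite rsumB ?SP ?SN//.
  - by move=> x; rewrite fine_ge0// S_ge0.
  - by move=> x; rewrite fine_ge0// S_ge0.
  - by apply: le_lt_trans SF; apply: le_esum => x _; apply: le_S => y.
  - by apply: le_lt_trans SF; apply: le_esum => x _; apply: le_S => y.
move=> SF; rewrite E//.
rewrite E; last by rewrite S_swap.
by rewrite S_swap// (@S_swap _ _ (fun x y => Num.max (- F x y) 0)).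
Qed.

Lemma normc_ge0 (z : R[i]) : 0 <= normc z.
Proof. by case: z => a b; exact: sqrtr_ge0. Qed.

#[local] Hint Resolve normc_ge0 : core.

Let Re_le (z : R[i]) : `|complex.Re z| <= normc z.
Proof. by case: z => a b /=; rewrite -sqrtr_sqr ler_wsqrtr// lerDl sqr_ge0. Qed.

Let Im_le (z : R[i]) : `|complex.Im z| <= normc z.
Proof. by case: z => a b /=; rewrite -sqrtr_sqr ler_wsqrtr// lerDr sqr_ge0. Qed.

Let SRe T (f : T -> R[i]) : (S (fun x => normc (f x)) < +oo)%E ->
  (S (fun x => `|complex.Re (f x)|)%R < +oo)%E.
Proof. by apply: le_lt_trans; apply: le_S. Qed.

Let SIm T (f : T -> R[i]) : (S (fun x => normc (f x)) < +oo)%E ->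
  (S (fun x => `|complex.Im (f x)|)%R < +oo)%E.
Proof. by apply: le_lt_trans; apply: le_S. Qed.

Let addcE (a b c d : R) : (a +i* b + (c +i* d) = (a + c) +i* (b + d))%C.
Proof. by []. Qed.

Let mulcE (a b c d : R) :
  ((a +i* b) * (c +i* d) = (a * c - b * d) +i* (a * d + b * c))%C.
Proof. by []. Qed.

Lemma csumD T (f g : T -> R[i]) :
  (\esum_(x in setT) (normc (f x))%:E < +oo)%E ->
  (\esum_(x in setT) (normc (g x))%:E < +oo)%E ->
  csum (fun x => f x + g x) = csum f + csum g.
Proof.
move=> Sf Sg; rewrite /csum addcE; congr Complex.
  rewrite -(rsumD (SRe Sf) (SRe Sg)); congr rsum; apply/funext => x.
  by case: (f x) => ? ?; case: (g x).
rewrite -(rsumD (SIm Sf) (SIm Sg)); congr rsum; apply/funext => x.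
by case: (f x) => ? ?; case: (g x).
Qed.

Lemma csumZ T (c : R[i]) (f : T -> R[i]) :
  (\esum_(x in setT) (normc (f x))%:E < +oo)%E ->
  csum (fun x => c * f x) = c * csum f.
Proof.
move=> Sf; case: c => a b; rewrite /csum mulcE.
have Sc (d : R) (h : T -> R) : (S (fun x => `|h x|)%R < +oo)%E ->
    (S (fun x => `|d * h x|)%R < +oo)%E.
  move=> Sh; rewrite (_ : (fun x => _) = fun x => `|d| * `|h x|); last first.
    by apply/funext => x; rewrite normrM.
  rewrite SZ// ltey_eq fin_numM// ge0_fin_numE// ; exact: S_ge0.
have [SR SI] := (SRe Sf, SIm Sf).
have Snb : (S (fun x => `|- (b * complex.Im (f x))|)%R < +oo)%E.
  rewrite (_ : (fun x => _) = fun x => `|b * complex.Im (f x)|); first exact: Sc.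
  by apply/funext => x; rewrite normrN.
rewrite -(rsumZ a SR) -(rsumZ b SI) -(rsumZ a SI) -(rsumZ b SR).
rewrite -(rsumN (fun x => b * complex.Im (f x))).
rewrite -(rsumD (Sc a _ SR) Snb) -(rsumD (Sc a _ SI) (Sc b _ SR)).
by congr Complex; congr rsum; apply/funext => x; case: (f x).
Qed.

Lemma csum_reindex T T' (e : T -> T') (f : T' -> R[i]) : set_bij setT setT e ->
  csum f = csum (fun x => f (e x)).
Proof. by move=> be; rewrite /csum !(rsum_reindex _ be). Qed.

Lemma csum1 T (a : T) (f : T -> R[i]) : (forall x, x != a -> f x = 0) ->
  csum f = f a.
Proof.
move=> f0; rewrite /csum !(@rsum1 _ a); first by case: (f a).
- by move=> x /f0 ->.
- by move=> x /f0 ->.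
Qed.

Lemma csum_swap T1 T2 (F : T1 -> T2 -> R[i]) :
  (\esum_(x in setT) \esum_(y in setT) (normc (F x y))%:E < +oo)%E ->
  csum (fun x => csum (F x)) = csum (fun y => csum (F ^~ y)).
Proof.
move=> SF; rewrite /csum /=; congr Complex; apply: rsum_swap.
  by apply: le_lt_trans SF; apply: le_esum => x _; apply: le_S.
by apply: le_lt_trans SF; apply: le_esum => x _; apply: le_S.
Qed.

Lemma normc_csum_le T (f : T -> R[i]) :
  (\esum_(x in setT) (normc (f x))%:E < +oo)%E ->
  ((normc (csum f))%:E <= \esum_(x in setT) (normc (f x))%:E)%E.
Proof.
move=> Sf; have [->|n0] := eqVneq (csum f) 0; first by rewrite normc0; exact: S_ge0.
pose c := (normc (csum f))%:C%C * (csum f)^-1.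
have nc : normc c = 1.
  rewrite normcM normcV /= expr0n /= addr0 sqrtr_sqr ger0_norm// divff//.
  by apply: contra n0 => /eqP h; apply/eqP/eq0_normc.
have : csum (fun x => c * f x) = (normc (csum f))%:C%C.
  by rewrite csumZ// /c mulfVK.
move=> /(congr1 (@complex.Re R)) /= <-.
have E : S (fun x => normc (c * f x)) = S (fun x => normc (f x)).
  by congr S; apply/funext => x; rewrite normcM nc mul1r.
rewrite -(@fineK _ (\esum_(x in _) _)%E); last first.
  by rewrite ge0_fin_numE// S_ge0.
rewrite lee_fin -/(S _) -E; apply: rsum_le => //.
- by move=> x; rewrite (le_trans (ler_norm _)).
- by rewrite E.
Qed.

End unordered_sum.

Definition abs_summable (R : realType) (T : choiceType) : {pred T -> R[i]} :=
  [pred f | (\esum_(x in setT) (normc (f x))%:E < +oo)%E].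

(* l^1(G) for the counting measure on the discrete group G *)
Record l1 (R : realType) (G : groupType) := L1 {
  l1_fun :> G -> R[i];
  l1_summable : l1_fun \in @abs_summable R G
}.

Section l1_module.
Variables (R : realType) (G : groupType).

HB.instance Definition _ := [isSub for @l1_fun R G].
HB.instance Definition _ := [Choice of l1 R G by <:].

Fact abs_summable_submod : submod_closed (@abs_summable R G).
Proof.
split=> [|c f g]; rewrite !inE.
  by rewrite esum1// => x _; rewrite normc0.
move=> Sf Sg.
have /le_lt_trans : (\esum_(x in setT) (normc ((c *: f + g) x))%:E <=
    (normc c)%:E * (\esum_(x in setT) (normc (f x))%:E) +
    \esum_(x in setT) (normc (g x))%:E)%E.
  rewrite -esumZl ?normc_ge0//; last by move=> x; exact: normc_ge0.
  rewrite -esumD; last 2 first.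
  - by move=> x _; rewrite lee_fin mulr_ge0 ?normc_ge0.
  - by move=> x _; rewrite lee_fin normc_ge0.
  apply: le_esum => x _; rewrite -EFinD lee_fin.
  by rewrite (le_trans (le_normcD _ _))// normcM.
apply; rewrite lte_add_pinfty// ltey_eq fin_numM//.
by rewrite ge0_fin_numE// esum_ge0// => x _; rewrite lee_fin normc_ge0.
Qed.

HB.instance Definition _ :=
  GRing.isSubmodClosed.Build R[i] (G -> R[i]) (@abs_summable R G) abs_summable_submod.
HB.instance Definition _ := [SubChoice_isSubLmodule of l1 R G by <:].
End l1_module.

Definition l1_norm (R : realType) (G : groupType) (f : l1 R G) : R[i] :=
  (fine (\esum_(x in setT) (normc (f x))%:E)%E)%:C%C.

Definition conv (R : realType) (G : groupType) (f g : G -> R[i]) : G -> R[i] :=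
  fun s => csum (fun t => f t * g (t^-1 * s)%g).

Section l1_algebra.
Variables (R : realType) (G : groupType).
Implicit Types (f g h : l1 R G) (c : R[i]).

#[local] Hint Extern 0 (is_true (0 <= normc _)) => solve [exact: normc_ge0] : core.

Let N (F : G -> R[i]) : \bar R := (\esum_(x in setT) (normc (F x))%:E)%E.

Let N_ge0 F : (0 <= N F)%E.
Proof. by apply: esum_ge0 => x _; rewrite lee_fin. Qed.

Let N_fin f : N f \is a fin_num.
Proof. by rewrite ge0_fin_numE//; have := l1_summable f; rewrite inE. Qed.

Let le_N f x : normc (f x) <= fine (N f).
Proof.
rewrite -lee_fin fineK// /N (esumID [set x])//; last by move=> *; rewrite lee_fin.
rewrite setTI esum_set1 ?lee_fin// leeDl// esum_ge0// => y _.
by rewrite lee_fin.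
Qed.

Lemma l1P f g : (forall x, f x = g x) -> f = g.
Proof. by move=> fg; apply/val_inj/funext. Qed.

Let l1DE f g x : (f + g) x = f x + g x. Proof. by []. Qed.

Let l1ZE c f x : (c *: f) x = c * f x. Proof. by []. Qed.

Let l1_normD f g : l1_norm (f + g) <= l1_norm f + l1_norm g.
Proof.
have le_ND : (N (f + g)%R <= N f + N g)%E.
  rewrite /N -esumD; last 2 first.
  - by move=> *; rewrite lee_fin normc_ge0.
  - by move=> *; rewrite lee_fin normc_ge0.
  by apply: le_esum => x _; rewrite -EFinD lee_fin le_normcD.
rewrite /l1_norm -!/(N _) -rmorphD/= lecR -fineD ?N_fin//.
by apply: fine_le le_ND; [exact: N_fin|rewrite fin_numD !N_fin].
Qed.

Let l1_normZ c f : l1_norm (c *: f) = `|c| * l1_norm f.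
Proof.
have NZ : N (c *: f)%R = ((normc c)%:E * N f)%E.
  rewrite /N -esumZl//.
  by apply: eq_esum => x _; rewrite l1ZE normcM.
rewrite /l1_norm -/(N _) -/(N f) NZ fineM ?N_fin//= rmorphM/=.
by congr (_ * _).
Qed.

Let l1_norm0_eq0 f : l1_norm f = 0 -> f = 0.
Proof.
move=> /(congr1 (@complex.Re R)) /= N0; apply: l1P => x.
apply: eq0_normc; apply/eqP; rewrite eq_le normc_ge0 andbT -N0.
exact: le_N.
Qed.

HB.instance Definition _ := Lmodule_isNormed.Build R[i] (l1 R G)
  l1_normD l1_normZ l1_norm0_eq0.

Let bij_mull (t : G) : set_bij setT setT (fun s : G => t * s)%g.
Proof.
rewrite setTT_bijective; exists (fun s => t^-1 * s)%g => s.
  by rewrite mulKg.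
by rewrite mulVKg.
Qed.

Let esum_conv f g :
  (\esum_(s in setT) \esum_(t in setT) (normc (f t * g (t^-1 * s)%g))%:E =
   N f * N g)%E.
Proof.
rewrite esum_swap//.
transitivity (\esum_(t in setT) (fine (N g) * normc (f t))%:E)%E.
  apply: eq_esum => t _; rewrite mulrC EFinM fineK// -esumZl//.
  rewrite [RHS](reindex_esum setT setT _ _ (bij_mull t^-1)).
  by apply: eq_esum => s _; rewrite normcM.
by rewrite esumZl// ?fine_ge0// fineK// muleC.
Qed.

Let conv_pt f g s :
  (\esum_(t in setT) (normc (f t * g (t^-1 * s)%g))%:E < +oo)%E.
Proof.
apply: (@le_lt_trans _ _ (\esum_(t in setT) (fine (N g) * normc (f t))%:E)%E).
  by apply: le_esum => t _; rewrite lee_fin normcM mulrC ler_wpM2r// le_N.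
by rewrite esumZl// ?fine_ge0// fineK// -/(N f) ltey_eq fin_numM.
Qed.

Let le_N_conv f g : (N (conv f g) <= N f * N g)%E.
Proof.
rewrite -esum_conv; apply: le_esum => s _.
exact: (normc_csum_le (conv_pt f g s)).
Qed.

Fact conv_summable f g : conv f g \in @abs_summable R G.
Proof.
by rewrite inE; apply: le_lt_trans (le_N_conv f g) _; rewrite ltey_eq fin_numM.
Qed.

Definition l1_mul f g : l1 R G := L1 (conv_summable f g).

Let delta1 : G -> R[i] := fun x => (x == 1%g)%:R.

Fact delta1_summable : delta1 \in @abs_summable R G.
Proof.
rewrite inE (esumID [set 1%g])//; last by move=> *; rewrite lee_fin.
rewrite setTI esum_set1 ?lee_fin// setTI esum1 ?adde0 ?ltry// => x /= /eqP/negbTE.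
by rewrite /delta1 => ->; rewrite normc0.
Qed.

Definition l1_one : l1 R G := L1 delta1_summable.

Let l1_mulA : associative l1_mul.
Proof.
move=> f g h; apply: l1P => s /=; rewrite /conv /=.
have Sgh u := conv_pt g h (u^-1 * s)%g.
transitivity (csum (fun u => csum (fun t =>
    f u * g (u^-1 * t)%g * h (t^-1 * s)%g))).
  congr csum; apply/funext => u; rewrite -csumZ//.
  rewrite (csum_reindex _ (bij_mull u^-1)); congr csum; apply/funext => t.
  by rewrite mulrA invgM invgK -mulgA mulVKg.
rewrite csum_swap; last first.
  pose K := fine (N g) * fine (N h).
  have K0 : 0 <= K by rewrite mulr_ge0 ?fine_ge0.
  apply: (@le_lt_trans _ _ (\esum_(u in setT) (K * normc (f u))%:E)%E); last first.
    by rewrite esumZl// -/(N f) ltey_eq fin_numM.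
  apply: le_esum => u _.
  have -> : K * normc (f u) = normc (f u) * fine (N h) * fine (N g).
    by rewrite /K mulrC (mulrC (fine (N g))) mulrA.
  rewrite EFinM fineK// -esumZl// ?mulr_ge0 ?fine_ge0//.
  rewrite [leRHS](reindex_esum setT setT _ _ (bij_mull u^-1)).
  apply: le_esum => t _; rewrite lee_fin !normcM mulrAC ler_wpM2r//.
  by rewrite ler_wpM2l// le_N.
congr csum; apply/funext => t; rewrite [RHS]mulrC -csumZ//.
by congr csum; apply/funext => u; rewrite mulrC.
Qed.

Let l1_mul1 : left_id l1_one l1_mul.
Proof.
move=> f; apply: l1P => s /=; rewrite /conv (@csum1 _ _ 1%g) /=.
  by rewrite /delta1 eqxx mul1r invg1 mul1g.
by move=> t /negbTE t1; rewrite /delta1 t1 mul0r.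
Qed.

Let l1_mulr1 : right_id l1_one l1_mul.
Proof.
move=> f; apply: l1P => s /=; rewrite /conv (@csum1 _ _ s) /=.
  by rewrite /delta1 mulVg eqxx mulr1.
move=> t ts; rewrite /delta1; case: eqP => [e|_]; last by rewrite mulr0.
by case/eqP: ts; rewrite -(mulVKg t s) e mulg1.
Qed.

Let l1_mulDl : left_distributive l1_mul +%R.
Proof.
move=> f g h; apply: l1P => s; rewrite l1DE /= /conv -csumD//.
by congr csum; apply/funext => t; exact: mulrDl.
Qed.

Let l1_mulDr : right_distributive l1_mul +%R.
Proof.
move=> f g h; apply: l1P => s; rewrite l1DE /= /conv -csumD//.
by congr csum; apply/funext => t; exact: mulrDr.
Qed.

Let l1_one_neq0 : l1_one != 0.
Proof.
apply/eqP => /(congr1 (fun f : l1 R G => f 1%g)) /= /eqP.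
by rewrite /delta1 eqxx oner_eq0.
Qed.

HB.instance Definition _ := GRing.Zmodule_isNzRing.Build (l1 R G)
  l1_mulA l1_mul1 l1_mulr1 l1_mulDl l1_mulDr l1_one_neq0.

Let l1_scaleAl c f g : c *: (f * g) = c *: f * g.
Proof.
apply: l1P => s; rewrite l1ZE /= /conv -csumZ//.
by congr csum; apply/funext => t; exact: mulrA.
Qed.

HB.instance Definition _ :=
  GRing.Lmodule_isLalgebra.Build R[i] (l1 R G) l1_scaleAl.

Let l1_scaleAr c f g : c *: (f * g) = f * (c *: g).
Proof.
apply: l1P => s; rewrite l1ZE /= /conv -csumZ//.
by congr csum; apply/funext => t; exact: mulrCA.
Qed.

HB.instance Definition _ :=
  GRing.Lalgebra_isAlgebra.Build R[i] (l1 R G) l1_scaleAr.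

Lemma l1_normE f : `|f| = l1_norm f. Proof. by []. Qed.

Lemma l1_mulE f g s : (f * g) s = conv f g s. Proof. by []. Qed.

Lemma l1_normM f g : `|f * g| <= `|f| * `|g|.
Proof.
rewrite !l1_normE /l1_norm -!/(N _) -rmorphM/= lecR -fineM ?N_fin//.
by apply: fine_le (le_N_conv f g); [exact: (N_fin (f * g))|rewrite fin_numM ?N_fin].
Qed.

End l1_algebra.

Section automorphisms.
Variables (R : realType) (G : groupType).
Implicit Types T Phi : l1 R G -> l1 R G.

Definition isometric_automorphism T : Prop :=
  [/\ linear T, {morph T : a b / a * b}, bijective T & forall a, `|T a| = `|a|].

Definition approx_local_isometric_automorphism Phi : Prop :=
  linear Phi /\
  forall a, exists Phi_ : nat -> l1 R G -> l1 R G,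
    (forall n, isometric_automorphism (Phi_ n)) /\
    Phi_ n a @[n --> \oo] --> Phi a.

End automorphisms.

(* Main.v *)
(* An isometric automorphism maps each point mass to a unimodular multiple of a
   point mass, and this property passes to norm limits, so Phi is isometric and
   acts as f |-> chi f followed by a push-forward along an injection phi.  The
   values of d_s + 2 d_t + 4 d_st at distinct points of {s, t, st} are distinct
   subset sums of {1, 2, 4}, so an automorphism T with T f close to Phi f, for
   this f, must be close to Phi on the point masses at s, t and st.  Hence Phi
   is multiplicative on point masses, and everywhere by density. *)
Require Import Defs.
From mathcomp Require Import all_boot all_order all_algebra.
From mathcomp Require Import complex.
From mathcomp Require Import boolp classical_sets functions.
From mathcomp Require Import reals topology normedtype.
From mathcomp Require Import finmap cardinality fsbigop ereal esum.

Set Implicit Arguments.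
Unset Strict Implicit.
Unset Printing Implicit Defensive.
Import Order.TTheory GRing.Theory Num.Theory.
Import numFieldNormedType.Exports.

Local Open Scope classical_set_scope.
Local Open Scope ring_scope.

(** * Norm, point masses and density in l^1(G) *)

Section l1_basics.
Variables (R : realType) (G : groupType).
Implicit Types (f g u v : l1 R G) (s t x y : G) (c e : R[i]).

Lemma normcE c : `|c| = (Normc.normc c)%:C%C.
Proof. by case: c. Qed.

Lemma l1DE f g x : (f + g) x = f x + g x. Proof. by []. Qed.

Lemma l1NE f x : (- f) x = - f x. Proof. by []. Qed.

Lemma l1ZE c f x : (c *: f) x = c * f x. Proof. by []. Qed.

Lemma l1_sumE (I : Type) (r : seq I) (F : I -> l1 R G) x :
  (\sum_(i <- r) F i) x = \sum_(i <- r) F i x.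
Proof. by elim/big_rec2: _ => // i a b _ <-. Qed.

Lemma esum_normc_fin f :
  (\esum_(x in setT) (Normc.normc (f x))%:E)%E \is a fin_num.
Proof.
rewrite ge0_fin_numE; first by have := l1_summable f; rewrite inE.
by apply: esum_ge0 => x _; rewrite lee_fin normc_ge0.
Qed.

Lemma indicator_summable s : (fun x : G => (x == s)%:R) \in @abs_summable R G.
Proof.
have n0 x : (0 <= (Normc.normc ((x == s)%:R : R[i]))%:E)%E.
  by rewrite lee_fin normc_ge0.
rewrite inE (esumID [set s])//.
rewrite setTI esum_set1// setTI esum1 ?adde0 ?ltry// => x /= /eqP/negbTE ->.
by rewrite Normc.normc0.
Qed.

Definition l1_delta s : l1 R G := L1 (indicator_summable s).

Lemma l1_deltaE s x : l1_delta s x = (x == s)%:R. Proof. by []. Qed.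

Lemma l1_tailE f (r : seq G) x : uniq r ->
  (f - \sum_(s <- r) f s *: l1_delta s) x = if x \in r then 0 else f x.
Proof.
move=> ur; rewrite l1DE l1NE l1_sumE.
under eq_bigr do rewrite l1ZE l1_deltaE.
case: ifPn => xr.
  rewrite (bigD1_seq x)//= eqxx mulr1 big1 ?addr0 ?subrr// => s /negbTE.
  by rewrite eq_sym => ->; rewrite mulr0.
rewrite big_seq big1 ?subr0// => s sr; case: eqP => [xs|]; rewrite ?mulr0//.
by rewrite xs sr in xr.
Qed.

(** The remainder is zero on [r] and equals [f] elsewhere, so the sum of moduli splits along [r] and
    its complement. *)
Lemma l1_norm_split f (r : seq G) : uniq r ->
  `|f| = \sum_(s <- r) `|f s| + `|f - \sum_(s <- r) f s *: l1_delta s|.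
Proof.
move=> ur; move: (f - _) (fun x => l1_tailE f x ur) => h hE.
have n0 (k : l1 R G) x : (0 <= (Normc.normc (k x))%:E)%E.
  by rewrite lee_fin normc_ge0.
have split_esum : (\esum_(x in setT) (Normc.normc (f x))%:E =
    (\sum_(s <- r) Normc.normc (f s))%:E +
    \esum_(x in setT) (Normc.normc (h x))%:E)%E.
  rewrite (esumID [set` r])// [in RHS](esumID [set` r])// !setTI.
  congr (_ + _)%E.
    rewrite esum_fset//; last by apply/finite_seqP; exists r.
    by rewrite -fsbig_seq// sumEFin.
  rewrite [X in _ = (X + _)%E]esum1 ?add0e => [|x /= xr].
    by apply: eq_esum => x /= /negP/negbTE xr; rewrite hE xr.
  by rewrite hE xr Normc.normc0.
have {}split_esum := congr1 fine split_esum.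
rewrite fineD ?esum_normc_fin// in split_esum.
by rewrite !l1_normE /l1_norm split_esum rmorphD rmorph_sum.
Qed.

Lemma l1_norm_sum_le f (r : seq G) : uniq r -> \sum_(s <- r) `|f s| <= `|f|.
Proof. by move=> ur; rewrite (l1_norm_split f ur) lerDl. Qed.

Lemma le_l1_norm f x : `|f x| <= `|f|.
Proof. by have := @l1_norm_sum_le f [:: x]; rewrite big_seq1; apply. Qed.

Lemma l1_norm_delta s : `|l1_delta s| = 1.
Proof.
rewrite (@l1_norm_split _ [:: s])// !big_seq1 l1_deltaE eqxx scale1r subrr.
by rewrite normr0 addr0 normr1.
Qed.

Lemma l1_concentrated f x : `|f| = `|f x| -> f = f x *: l1_delta x.
Proof.
rewrite (@l1_norm_split _ [:: x])// !big_seq1 => /eqP.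
by rewrite -subr_eq0 addrAC subrr add0r normr_eq0 subr_eq0 => /eqP.
Qed.

Lemma l1_delta_dense f e : 0 < e ->
  exists r : seq G, `|f - \sum_(s <- r) f s *: l1_delta s| < e.
Proof.
(* Positivity in [R[i]] forces [e] to be real, so the estimate can be made in [R]. *)
rewrite ltcE => /andP[/eqP /= ime ree].
set S := (\esum_(x in setT) (Normc.normc (f x))%:E)%E.
have : ((fine S - complex.Re e)%:E < S)%E.
  by rewrite -[ltRHS]fineK ?esum_normc_fin// lte_fin ltrBlDr ltrDl.
move=> /ereal_sup_gt[_ [A [finA _] <-]].
rewrite fsbig_finite// sumEFin lte_fin => ltA; exists (fset_set A).
rewrite -(ltrD2l (\sum_(s <- fset_set A) `|f s|)).
rewrite -l1_norm_split ?fset_uniq// -ltrBlDr.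
have -> : e = (complex.Re e)%:C%C by case: (e) ime => a b /= ->.
under eq_bigr do rewrite normcE.
by rewrite l1_normE /l1_norm -rmorph_sum -rmorphB/= ltcR.
Qed.

(** Subtracting multiples of point masses leaves [L f] unchanged, yet by density brings the norm
    below [|L f| / K] when [L f] is nonzero, against the bound. *)
Lemma l1_functional_eq0 (L : l1 R G -> R[i]) (K : R[i]) :
  scalar L -> (forall f, `|L f| <= K * `|f|) ->
  (forall s, L (l1_delta s) = 0) -> forall f, L f = 0.
Proof.
move=> linL bL L0 f.
have L_sub r : L (f - \sum_(s <- r) f s *: l1_delta s) = L f.
  elim: r => [|s r IH]; first by rewrite big_nil subr0.
  by rewrite big_cons opprD addrCA -scaleNr linL L0 mulr0 add0r.
apply/eqP; apply: contraT => Lf0.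
have Lf_gt0 : 0 < `|L f| by rewrite normr_gt0.
have K0 : 0 < K.
  rewrite lt_neqAle; apply/andP; split.
    by apply: contraTneq (bL f) => <-; rewrite mul0r normr_le0.
  have := bL (l1_delta 1%g); rewrite l1_norm_delta mulr1.
  exact: le_trans.
have [r] := @l1_delta_dense f (`|L f| / K) (divr_gt0 Lf_gt0 K0).
rewrite -(ltr_pM2l K0) [ltRHS]mulrC divfK ?gt_eqF// => /(le_lt_trans (bL _)).
by rewrite L_sub ltxx.
Qed.

Lemma l1_deltaM s t : l1_delta s * l1_delta t = l1_delta (s * t)%g.
Proof.
apply: l1P => x; rewrite l1_mulE /conv (@csum1 _ _ s) /=.
  by rewrite eqxx mul1r (can2_eq (mulVKg s) (mulKg s)).
by move=> y /negbTE ->; rewrite mul0r.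
Qed.

Lemma l1_delta1 : l1_delta 1%g = 1.
Proof. exact: l1P. Qed.

(* If [u * v = 1] with norms 1, then [1 <= \sum_t |u t| |v t^-1|] forces
   [|v t^-1| = 1] wherever [u t != 0]. *)
Lemma l1_unit_monomial u v : u * v = 1 -> `|u| = 1 -> `|v| = 1 ->
  exists c x, v = c *: l1_delta x /\ `|c| = 1.
Proof.
move=> uv u1 v1.
have [t ut] : exists t, u t != 0.
  apply: contrapT => /forallNP u0.
  have u_eq0 : u = 0 by apply: l1P => t; have /negP/negPn/eqP := u0 t.
  by move/eqP: u1; rewrite u_eq0 normr0 eq_sym oner_eq0.
suff vt : `|v t^-1%g| = 1.
  exists (v t^-1%g), t^-1%g; split=> //; apply: l1_concentrated.
  by rewrite vt.
have vle x : Normc.normc (v x) <= 1.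
  by rewrite -lecR -normcE -[leRHS]v1 le_l1_norm.
apply/eqP; rewrite eq_le -{1}v1 le_l1_norm/= normcE lecR leNgt.
apply/negP => vlt.
(* [F] lists the moduli of the terms of [(u * v) 1], and [H] completes them to the moduli of [u].
   The two sums add up to 1 and that of [F] is at least 1, so [H] sums to at most 0, although [H t]
   is positive. *)
pose F x := Normc.normc (u x * v (x^-1 * 1)%g).
pose H x := Normc.normc (u x) * (1 - Normc.normc (v x^-1)%g).
have F0 x : 0 <= F x by exact: normc_ge0.
have H0 x : 0 <= H x by rewrite mulr_ge0 ?normc_ge0 ?subr_ge0.
have FH : (\esum_(x in setT) (F x)%:E + \esum_(x in setT) (H x)%:E = 1)%E.
  rewrite -esumD; [|by move=> *; rewrite lee_fin..].
  have /(congr1 (@complex.Re R)) : `|u| = (1%:C)%C by rewrite u1.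
  rewrite l1_normE /= => <-; rewrite fineK ?esum_normc_fin//.
  apply: eq_esum => x _; rewrite -EFinD /F /H mulg1 Normc.normcM -mulrDr.
  by rewrite addrC subrK mulr1.
have F1 : (1 <= \esum_(x in setT) (F x)%:E)%E.
  have /(congr1 (fun k : l1 R G => k 1%g)) := uv.
  rewrite -l1_delta1 l1_deltaE eqxx l1_mulE /conv => E1.
  have := @normc_csum_le R G (fun x => u x * v (x^-1 * 1)%g).
  rewrite E1 Normc.normc1; apply.
  apply: (@le_lt_trans _ _ 1%:E); last exact: ltry.
  by rewrite -[leRHS]FH leeDl// esum_ge0// => x _; rewrite lee_fin.
have Ht : ((H t)%:E <= \esum_(x in setT) (H x)%:E)%E.
  apply: esum_ge; exists [set t]; first by split.
  by rewrite fsbig_set1.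
have : (1 + (H t)%:E <= 1 :> \bar R)%E by rewrite -{2}FH leeD.
rewrite -EFinD lee_fin gerDl leNgt mulr_gt0// ?subr_gt0//.
rewrite lt_neqAle normc_ge0 andbT eq_sym; apply: contra ut => /eqP u0.
by rewrite (Normc.eq0_normc u0).
Qed.

End l1_basics.

(** * Isometries sending point masses to unimodular multiples of point masses *)

Section weighted_push_maps.
Variables (R : realType) (G : groupType).
Implicit Types (f g u v : l1 R G) (s t x y : G) (c e : R[i]).
Implicit Types T Phi L : l1 R G -> l1 R G.

(** Two points with nonzero value cannot coexist, since any approximating monomial misses one of
    them. *)
Lemma l1_limit_monomial u :
  (forall e, 0 < e -> exists c x, `|c| = 1 /\ `|u - c *: l1_delta R x| < e) ->
  exists c x, u = c *: l1_delta R x /\ `|c| = 1.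
Proof.
move=> hu.
have u1 : `|u| = 1.
  apply/eqP; rewrite -subr_eq0 -normr_eq0; apply: contraT.
  rewrite -normr_gt0 normr_id => /hu[c [x [c1]]].
  move=> /(le_lt_trans (ler_dist_dist _ _)).
  by rewrite normrZ l1_norm_delta c1 mulr1 ltxx.
have [y uy] : exists y, u y != 0.
  apply: contrapT => /forallNP u0.
  have u_eq0 : u = 0 by apply: l1P => t; have /negP/negPn/eqP := u0 t.
  by move/eqP: u1; rewrite u_eq0 normr0 eq_sym oner_eq0.
have u_supp z : z != y -> u z = 0.
  move=> zy; apply/eqP; apply: contraT => uz.
  (* Both factors are at most 1, so this tolerance is below each of them and serves whichever of [y]
     and [z] differs from [x]. *)
  have [] := hu (`|u y| * `|u z|); first by rewrite mulr_gt0 ?normr_gt0.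
  move=> c [x [_ lt_uc]].
  have ule w : `|u w| <= 1 by rewrite -u1 le_l1_norm.
  have off w : w != x -> `|u w| < `|u y| * `|u z|.
    move=> /negbTE wx; apply: le_lt_trans lt_uc.
    apply: le_trans (le_l1_norm _ w).
    by rewrite l1DE l1NE l1ZE l1_deltaE wx mulr0 subr0.
  have [yx|/off] := eqVneq y x.
    have := off z; rewrite -yx => /(_ zy) /lt_le_trans.
    by move=> /(_ _ (ler_piMl (normr_ge0 _) (ule y))); rewrite ltxx.
  by move=> /lt_le_trans /(_ (ler_piMr (normr_ge0 _) (ule z))); rewrite ltxx.
have uE : u = u y *: l1_delta R y.
  apply: l1P => z; rewrite l1ZE l1_deltaE; have [->|/u_supp ->] := eqVneq z y.
    by rewrite mulr1.
  by rewrite mulr0.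
exists (u y), y; split=> //.
by rewrite -[RHS]u1 [in RHS]uE normrZ l1_norm_delta mulr1.
Qed.

(** The images of the point masses at [s] and [s^-1] have norm 1 and product 1. *)
Lemma isometric_automorphism_delta T s : isometric_automorphism T ->
  exists c x, T (l1_delta R s) = c *: l1_delta R x /\ `|c| = 1.
Proof.
move=> [linT mulT [U UK TK] isoT].
have T1 : T 1 = 1 by rewrite -[LHS]mulr1 -[X in _ * X]TK -mulT mul1r TK.
apply: (@l1_unit_monomial _ _ (T (l1_delta R s^-1))).
- by rewrite -mulT l1_deltaM mulVg l1_delta1 T1.
- by rewrite isoT l1_norm_delta.
- by rewrite isoT l1_norm_delta.
Qed.

Lemma approx_local_within Phi f e :
  approx_local_isometric_automorphism Phi -> 0 < e ->
  exists2 T, isometric_automorphism T & `|Phi f - T f| < e.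
Proof.
move=> [_ /(_ f)[Phi_ [isoPhi_ cvgPhi_]]] e0.
have [n ltn] := filter_ex (cvgr_dist_lt _ _ cvgPhi_ _ e0).
by exists (Phi_ n).
Qed.

(** An automorphism whose value at [f] is closer to [Phi f] than the gap between [|Phi f|] and [|f|]
    would break the reverse triangle inequality. *)
Lemma approx_local_isometry Phi f :
  approx_local_isometric_automorphism Phi -> `|Phi f| = `|f|.
Proof.
move=> aPhi; apply/eqP; rewrite -subr_eq0 -normr_eq0; apply: contraT.
rewrite -normr_gt0 normr_id => /(approx_local_within f aPhi)[T [_ _ _ isoT]].
by move=> /(le_lt_trans (ler_dist_dist _ _)); rewrite isoT ltxx.
Qed.

Lemma approx_local_delta Phi s : approx_local_isometric_automorphism Phi ->
  exists c x, Phi (l1_delta R s) = c *: l1_delta R x /\ `|c| = 1.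
Proof.
move=> aPhi; apply: l1_limit_monomial => e.
move=> /(approx_local_within (l1_delta R s) aPhi)[T].
move=> /(isometric_automorphism_delta s)[c [x [-> c1]]] lt_e.
by exists c, x.
Qed.

Lemma linear_isometry_inj L : linear L -> (forall f, `|L f| = `|f|) ->
  injective L.
Proof.
move=> linL isoL f g fg; apply/eqP; rewrite -subr_eq0 -normr_eq0 -isoL.
by rewrite addrC -scaleN1r linL fg scaleN1r addNr normr0.
Qed.

Definition weighted_push L (chi : G -> R[i]) (phi : G -> G) :=
  [/\ forall s, `|chi s| = 1, injective phi,
      forall f s, L f (phi s) = chi s * f s &
      forall f y, (forall s, phi s != y) -> L f y = 0].

(** Both value formulas say that a bounded functional of [f] vanishes, so checking them on point
    masses suffices. *)
Lemma weighted_pushP L : linear L -> (forall f, `|L f| = `|f|) ->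
  (forall s, exists c x, L (l1_delta R s) = c *: l1_delta R x /\ `|c| = 1) ->
  exists chi phi, weighted_push L chi phi.
Proof.
move=> linL isoL /choice[chi /choice[phi Ldelta]].
have L0 : L 0 = 0 by apply/eqP; rewrite -normr_eq0 isoL normr0.
have chi1 s : `|chi s| = 1 by have [] := Ldelta s.
have Ld s y : L (l1_delta R s) y = chi s * (y == phi s)%:R.
  by have [-> _] := Ldelta s; rewrite l1ZE l1_deltaE.
have chi0 s : chi s != 0 by rewrite -normr_eq0 chi1 oner_eq0.
have phi_inj : injective phi.
  move=> s t st; apply: contrapT => /eqP nst.
  (* If [phi s = phi t], then [L] kills this combination, whose value at [s] is the nonzero
     [chi t]. *)
  have : chi t *: l1_delta R s - chi s *: l1_delta R t = 0.
    apply: (linear_isometry_inj linL isoL).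
    rewrite -scaleNr -[_ *: l1_delta R t]addr0 !linL L0 addr0.
    apply: l1P => y; rewrite l1DE !l1ZE !Ld st mulNr.
    by rewrite [X in X + _]mulrCA subrr.
  move=> /(congr1 (fun k : l1 R G => k s))/eqP.
  rewrite l1DE l1NE !l1ZE !l1_deltaE eqxx (negbTE nst) mulr1 mulr0 subr0.
  by rewrite (negbTE (chi0 _)).
exists chi, phi; split=> // [f s|f y yphi].
  apply/eqP; rewrite -subr_eq0; apply/eqP.
  pose D (k : l1 R G) := L k (phi s) - chi s * k s.
  apply: (@l1_functional_eq0 _ _ D 2%:R); rewrite /D.
  - move=> c g h; rewrite linL !l1DE !l1ZE mulrDr mulrBr opprD addrACA.
    by congr (_ - _ + _); exact: mulrCA.
  - move=> g; rewrite (le_trans (ler_normB _ _))// mulr_natl mulr2n lerD//.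
      by rewrite -[leRHS]isoL le_l1_norm.
    by rewrite normrM chi1 mul1r le_l1_norm.
  - move=> t; rewrite Ld l1_deltaE (inj_eq phi_inj).
    by case: eqP => [->|_]; rewrite ?mulr0 subrr.
apply: (@l1_functional_eq0 _ _ (fun k : l1 R G => L k y) 1).
- by move=> c g h; rewrite linL.
- by move=> g; rewrite mul1r -[leRHS]isoL le_l1_norm.
- by move=> t; rewrite Ld eq_sym (negbTE (yphi t)) mulr0.
Qed.

Lemma natr_dist_lt1 (m n : nat) : `|m%:R - n%:R : R[i]| < 1 -> m = n.
Proof.
wlog le_nm : m n / (n <= m)%N => [H mn|].
  have [/H ->//|/ltnW/H ->//] := leqP n m.
  by rewrite distrC.
rewrite -natrB// normr_nat ltrn1 ltnS leqn0 subn_eq0 => le_mn.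
by apply/eqP; rewrite eqn_leq le_mn.
Qed.

(* The moduli of the coefficients of [f] are distinct from [n r] off [r], so
   closeness of the images forces both maps to move [r] to the same place. *)
Lemma weighted_push_peak L T chi phi eta psi f (n : G -> nat) r e :
  weighted_push L chi phi -> weighted_push T eta psi ->
  (forall x, f x = (n x)%:R) -> (0 < n r)%N -> (forall x, n x = n r -> x = r) ->
  e <= 1 -> `|L f - T f| < e -> `|L (l1_delta R r) - T (l1_delta R r)| < e.
Proof.
move=> [chi1 phi_inj Lphi Loff] [eta1 psi_inj Tpsi Toff] fn nr0 peak e1 LT.
have LTx x : `|L f x - T f x| < e.
  by apply: le_lt_trans LT; rewrite -l1NE -l1DE le_l1_norm.
(* At [phi r] the modulus of [L f] is [n r], and that of [T f] is some [n x], or 0 off the range of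
   [psi]; natural numbers closer than 1 are equal. *)
have psir : psi r = phi r.
  have := LTx (phi r); rewrite Lphi fn => /lt_le_trans/(_ e1) lt1.
  have [[x psix]|/forallNP psi_off] := pselect (exists x, psi x = phi r).
    move: lt1; rewrite -psix Tpsi fn => /(le_lt_trans (ler_dist_dist _ _)).
    rewrite !normrM chi1 eta1 !mul1r !normr_nat => /natr_dist_lt1 nrx.
    by rewrite (peak x).
  move: lt1; rewrite Toff; last by move=> x; apply/eqP; exact: psi_off.
  by rewrite subr0 normrM chi1 mul1r normr_nat ltrn1 ltnNge nr0.
have delta_eq x : L (l1_delta R r) x - T (l1_delta R r) x =
    (chi r - eta r) * (x == phi r)%:R.
  have [->|xr] := eqVneq x (phi r).
    by rewrite -{2}psir Lphi Tpsi l1_deltaE eqxx !mulr1.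
  have off (K : l1 R G -> l1 R G) a k : weighted_push K a k -> k r = phi r ->
      K (l1_delta R r) x = 0.
    move=> [_ _ Kk Koff] kr.
    have [[y kyx]|/forallNP k_off] := pselect (exists y, k y = x).
      rewrite -kyx Kk l1_deltaE; case: eqP => [yr|]; rewrite ?mulr0//.
      by move: xr; rewrite -kyx yr kr eqxx.
    by apply: Koff => y; apply/eqP; exact: k_off.
  by rewrite (off L chi phi)// (off T eta psi)// subrr mulr0.
have -> : L (l1_delta R r) - T (l1_delta R r) =
    (chi r - eta r) *: l1_delta R (phi r).
  by apply: l1P => x; rewrite l1DE l1NE delta_eq l1ZE l1_deltaE.
rewrite normrZ l1_norm_delta mulr1.
(* As [|f r| = n r] is at least 1, the values at [phi r] differ at least as much as the weights. *)
apply: le_lt_trans (LTx (phi r)).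
by rewrite Lphi -psir Tpsi -mulrBl normrM fn normr_nat ler_peMr// ler1n.
Qed.

(** Approximants depend on the element, so one [f] has to carry all three point masses for a single
    [T] to serve them. *)
Lemma approx_local_triple Phi s t e : approx_local_isometric_automorphism Phi ->
  0 < e -> e <= 1 -> exists2 T, isometric_automorphism T &
    forall r, r \in [:: s; t; (s * t)%g] ->
    `|Phi (l1_delta R r) - T (l1_delta R r)| < e.
Proof.
move=> aPhi e0 e1; have [linPhi _] := aPhi.
pose n x := ((x == s) + 2 * (x == t) + 4 * (x == s * t)%g)%N.
pose f := l1_delta R s + 2%:R *: l1_delta R t + 4%:R *: l1_delta R (s * t)%g.
have fn x : f x = (n x)%:R.
  rewrite !l1DE !l1ZE /n (natrD _ (_ + _)%N) natrD.
  by rewrite !(natrM _ _ (nat_of_bool _)).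
have [T autT LT] := approx_local_within f aPhi e0.
exists T => // r rst; have [linT _ _ isoT] := autT.
have [chi [phi Phi_push]] := weighted_pushP linPhi
  (fun f => approx_local_isometry f aPhi) (fun s => approx_local_delta s aPhi).
have [eta [psi T_push]] := weighted_pushP linT isoT
  (fun s => isometric_automorphism_delta s autT).
apply: (weighted_push_peak Phi_push T_push fn) LT => //.
- move: rst; rewrite !inE /n.
  by case: (r == s); case: (r == t); case: (r == _)%g.
(* [n x = n r] means that [x] and [r] coincide with the same ones among [s], [t], [s * t]; [r]
   coincides with at least one, so [x = r]. *)
- move=> x; move: rst; rewrite !inE /n.
  case: (r =P s) => ?; case: (r =P t) => ?; case: (r =P s * t)%g => ? //= _;
  by case: (x =P s) => ?; case: (x =P t) => ?; case: (x =P s * t)%g => ? //= _;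
    congruence.
Qed.

End weighted_push_maps.

(** * Multiplicativity by density, and bijectivity *)

Theorem theorem4p3 (R : realType) (G : groupType) (Phi : l1 R G -> l1 R G) :
  approx_local_isometric_automorphism Phi ->
  set_surj [set: l1 R G] [set: l1 R G] Phi ->
  isometric_automorphism Phi.
Proof.
move=> aPhi surPhi; have [linPhi _] := aPhi.
have isoPhi f := approx_local_isometry f aPhi.
(* The defect of multiplicativity is bilinear and bounded, so it only has to vanish on pairs of
   point masses. *)
pose B f g : l1 R G := Phi (f * g) - Phi f * Phi g.
have B_bound f g x : `|B f g x| <= 2%:R * `|f| * `|g|.
  rewrite (le_trans (le_l1_norm _ _))// (le_trans (ler_normB _ _))//.
  rewrite mulrAC -mulrA mulr_natl mulr2n lerD//.
    by rewrite isoPhi [leRHS]mulrC l1_normM.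
  by rewrite (le_trans (l1_normM _ _))// !isoPhi mulrC.
have B_linl g x : scalar (fun f => B f g x).
  move=> c f h; rewrite /B mulrDl -scalerAl !linPhi mulrDl -scalerAl.
  by rewrite opprD addrACA -scalerBr.
have B_linr f x : scalar (fun g => B f g x).
  move=> c g h; rewrite /B mulrDr -scalerAr !linPhi mulrDr -scalerAr.
  by rewrite opprD addrACA -scalerBr.
have B_delta s t : B (l1_delta R s) (l1_delta R t) = 0.
  apply/eqP; rewrite -normr_eq0; apply: contraT; set b := `|_| => b0.
  have b_gt0 : 0 < b by rewrite lt_neqAle eq_sym b0 normr_ge0.
  have b1_gt0 : 0 < 1 + b by rewrite addr_gt0.
  (* With this choice [b < 3 e] would read [b * (1 + b) < b], impossible for positive [b]. *)
  pose e := b / (1 + b) / 3%:R.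
  have e_gt0 : 0 < e by rewrite !divr_gt0.
  have e_le1 : e <= 1.
    rewrite ler_pdivrMr// mul1r (@le_trans _ _ 1) ?ler1n//.
    by rewrite ler_pdivrMr// mul1r lerDr.
  have [T [linT mulT _ isoT] LT] := approx_local_triple s t aPhi e_gt0 e_le1.
  suff : b < e + (e + e).
    rewrite -mulr2n -mulrS -mulr_natr divfK ?pnatr_eq0// ltr_pdivlMr//.
    rewrite mulrDr mulr1 gtrDl => /(lt_trans (mulr_gt0 b_gt0 b_gt0)).
    by rewrite ltxx.
  rewrite /b /B.
  set u := Phi (l1_delta R s); set v := Phi (l1_delta R t).
  pose u' := T (l1_delta R s); pose v' := T (l1_delta R t).
  rewrite l1_deltaM.
  (* Since [T] is multiplicative, its value at the point mass of [s * t] is [u' * v']; this leaves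
     three terms of norm below [e]. *)
  have -> : Phi (l1_delta R (s * t)%g) - u * v =
      (Phi (l1_delta R (s * t)%g) - T (l1_delta R (s * t)%g)) -
      ((u - u') * v' + u * (v - v')).
    rewrite mulrBl mulrBr [X in _ = _ - X]addrC addrA subrK -l1_deltaM mulT.
    by rewrite opprB addrA subrK.
  have le_u : `|(u - u') * v'| <= `|u - u'|.
    by rewrite (le_trans (l1_normM _ _))// isoT l1_norm_delta mulr1.
  have le_v : `|u * (v - v')| <= `|v - v'|.
    by rewrite (le_trans (l1_normM _ _))// isoPhi l1_norm_delta mul1r.
  apply: le_lt_trans (ler_normB _ _) _; apply: ltrD.
    by apply: LT; rewrite !inE eqxx !orbT.
  apply: le_lt_trans (ler_normD _ _) _; apply: ltrD.
    by apply: le_lt_trans le_u _; apply: LT; rewrite inE eqxx.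
  by apply: le_lt_trans le_v _; apply: LT; rewrite !inE eqxx orbT.
have mulPhi : {morph Phi : f g / f * g}.
  move=> f g; apply/eqP; rewrite -subr_eq0; apply/eqP; apply: l1P => x.
  (* Density is applied to the second factor, then to the first against a point mass. *)
  apply: (l1_functional_eq0 (B_linr f x) (fun h => B_bound f h x)) => t.
  apply: (l1_functional_eq0 (B_linl (l1_delta R t) x) (K := 2%:R)) => [h|s].
    by rewrite -[leRHS]mulr1 -{2}(l1_norm_delta R t) B_bound.
  by rewrite B_delta.
(* Isometry gives injectivity, [surPhi] surjectivity. *)
split=> //; rewrite -setTT_bijective; split=> //.
exact: in2W (linear_isometry_inj linPhi isoPhi).
Qed.
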